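(* Let $(X,\mathbb{C})$ be a $\top$-convergence space over a group $(X,\cdot)$. Then $(X,\cdot,\mathbb{C})$ is a $\top$-convergence group if and only if the following two conditions are satisfied: (TCG1) for all $\mathbb{F},\mathbb{G}\in\mathbb{F}_L^\top(X)$ and all $x,y\in X$: if $\mathbb{F}\stackrel{\mathbb{C}}{\dashrightarrow}x$ and $\mathbb{G}\stackrel{\mathbb{C}}{\dashrightarrow}y$, then $\mathbb{F}\odot\mathbb{G}\stackrel{\mathbb{C}}{\dashrightarrow}xy$; (TCG2) for all $\mathbb{F}\in\mathbb{F}_L^\top(X)$ and all $x\in X$: if $\mathbb{F}\stackrel{\mathbb{C}}{\dashrightarrow}x$, then $\mathbb{F}^{-1}\stackrel{\mathbb{C}}{\dashrightarrow}x^{-1}$.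
   Context: Throughout, $L=(L,\ast)$ is a complete residuated lattice: $(L,\le)$ is a complete lattice with top $\top$ and bottom $\bot$, and $\ast$ is a commutative associative binary operation on $L$ with $a\ast\bigvee_{j}b_j=\bigvee_j(a\ast b_j)$ and $a\ast\top=a$. Put $a\to b=\bigvee\{c\in L: a\ast c\le b\}$. $L^X$ is the set of all maps $X\to L$, with pointwise order and operations. For $\lambda,\mu\in L^X$, $S_X(\lambda,\mu)=\bigwedge_{x\in X}(\lambda(x)\to\mu(x))$. A $\top$-filter on $X$ is a nonempty $\mathbb{F}\subseteq L^X$ such that: $\bigvee_{x\in X}\lambda(x)=\top$ for all $\lambda\in\mathbb{F}$; $\lambda\wedge\mu\in\mathbb{F}$ for all $\lambda,\mu\in\mathbb{F}$; and for $\lambda\in L^X$, $\bigvee_{\mu\in\mathbb{F}}S_X(\mu,\lambda)=\top$ implies $\lambda\in\mathbb{F}$. $\mathbb{F}_L^\top(X)$ is the set of $\top$-filters on $X$. A $\top$-filter base on $X$ is a nonempty $\mathbb{B}\subseteq L^X$ such that $\bigvee_{x}\lambda(x)=\top$ for all $\lambda\in\mathbb{B}$ and $\bigvee_{\nu\in\mathbb{B}}S_X(\nu,\lambda\wedge\mu)=\top$ for all $\lambda,\mu\in\mathbb{B}$; it generates the $\top$-filter $\{\lambda\in L^X:\bigvee_{\mu\in\mathbb{B}}S_X(\mu,\lambda)=\top\}$. For $x\in X$, $[x]_\top=\{\mu\in L^X:\mu(x)=\top\}$ (a $\top$-filter). For a map $f:X\to Y$ and $\mathbb{F}\in\mathbb{F}_L^\top(X)$,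 $f^\Rightarrow(\mathbb{F})=\{\mu\in L^Y:\mu\circ f\in\mathbb{F}\}\in\mathbb{F}_L^\top(Y)$. A $\top$-convergence space is a pair $(X,\mathbb{C})$ with $\mathbb{C}:\mathbb{F}_L^\top(X)\to 2^X$, writing $\mathbb{F}\stackrel{\mathbb{C}}{\dashrightarrow}x$ for $x\in\mathbb{C}(\mathbb{F})$, such that (TC1) $[x]_\top\stackrel{\mathbb{C}}{\dashrightarrow}x$ for all $x\in X$; (TC2) $\mathbb{F}\subseteq\mathbb{G}$ and $\mathbb{F}\stackrel{\mathbb{C}}{\dashrightarrow}x$ imply $\mathbb{G}\stackrel{\mathbb{C}}{\dashrightarrow}x$. A map $f:(X,\mathbb{C}_X)\to(Y,\mathbb{C}_Y)$ is continuous if $\mathbb{F}\stackrel{\mathbb{C}_X}{\dashrightarrow}x$ implies $f^\Rightarrow(\mathbb{F})\stackrel{\mathbb{C}_Y}{\dashrightarrow}f(x)$. The product structure $\mathbb{C}\times\mathbb{C}$ on $X\times X$ is given by $\mathbb{F}\stackrel{\mathbb{C}\times\mathbb{C}}{\dashrightarrow}(x_1,x_2)$ iff $p_i^\Rightarrow(\mathbb{F})\stackrel{\mathbb{C}}{\dashrightarrow}x_i$ for $i=1,2$, where $p_1,p_2$ are the projections. For a group $(X,\cdot)$ and a $\top$-convergence space $(X,\mathbb{C})$, the triple $(X,\cdot,\mathbb{C})$ is a $\top$-convergence group if $m:(X\times X,\mathbb{C}\times\mathbb{C})\to(X,\mathbb{C})$, $(x,y)\mapsto xy$, and $r:(X,\mathbb{C})\to(X,\mathbb{C})$,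 $x\mapsto x^{-1}$, are continuous. For $\lambda,\mu\in L^X$: $(\lambda\odot\mu)(z)=\bigvee_{xy=z}(\lambda(x)\wedge\mu(y))$ and $\lambda^{-1}(z)=\lambda(z^{-1})$. For $\top$-filters $\mathbb{F},\mathbb{G}$ on $X$, $\mathbb{F}\odot\mathbb{G}$ is the $\top$-filter generated by the $\top$-filter base $\{\lambda\odot\mu:\lambda\in\mathbb{F},\mu\in\mathbb{G}\}$, and $\mathbb{F}^{-1}=\{\lambda^{-1}:\lambda\in\mathbb{F}\}$ (a $\top$-filter). *)

(* Defs.v *)
From HB Require Import structures.
From mathcomp Require Import all_boot all_order.
From mathcomp Require Import boolp classical_sets.

Set Implicit Arguments.
Unset Strict Implicit.
Unset Printing Implicit Defensive.

Import Order.TTheory.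
Local Open Scope classical_set_scope.
Local Open Scope group_scope.

Declare Scope reslat_scope.
Delimit Scope reslat_scope with RL.
Local Open Scope reslat_scope.

(* It is enough to ask for suprema of arbitrary subsets: infima follow. *)
HB.mixin Record TBLattice_isComplete (d : Order.disp_t) L
    of Order.TBLattice d L := {
  supremums_neq0 : forall A : set L, supremums A !=set0
}.

#[short(type="completeLatticeType")]
HB.structure Definition CompleteLattice (d : Order.disp_t) :=
  { L of TBLattice_isComplete d L & Order.TBLattice d L }.

(* The default value only serves the empty set: every set has a supremum. *)
Definition lsup d (L : completeLatticeType d) (A : set L) : L :=
  supremum \bot%O A.
Definition linf d (L : completeLatticeType d) (A : set L) : L :=
  infimum \top%O A.

HB.mixin Record CompleteLattice_isResiduated (d : Order.disp_t) L
    of CompleteLattice d L := {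
  rmul : L -> L -> L;
  rmulC : commutative rmul;
  rmulA : associative rmul;
  rmul_lsupr : forall (a : L) (B : set L),
    rmul a (lsup B) = lsup [set rmul a b | b in B];
  rmul1 : right_id \top%O rmul
}.

#[short(type="completeResiduatedLatticeType")]
HB.structure Definition CompleteResiduatedLattice (d : Order.disp_t) :=
  { L of CompleteLattice_isResiduated d L & CompleteLattice d L }.

Notation "a ** b" := (rmul a b) (at level 40, left associativity)
  : reslat_scope.

Section Lattice.
Variables (d : Order.disp_t) (L : completeResiduatedLatticeType d).
Implicit Types (a b c : L) (A B : set L).

Definition residuum a b : L := lsup [set c | (a ** c <= b)%O].

Definition subsethood (X : Type) (l m : X -> L) : L :=
  linf (range (fun x => residuum (l x) (m x))).

(* The set L^X is rendered as the function type X -> L. *)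
Definition lset_meet (X : Type) (l m : X -> L) : X -> L :=
  fun x => (l x `&` m x)%O.

Lemma lsupP A : supremums A (lsup A).
Proof.
rewrite /lsup /supremum; case: ifPn => [/eqP -> | _].
  by split=> [x []//|y _]; rewrite le0x.
by case: xgetP => [y -> //|H]; case: (supremums_neq0 A) => x /H.
Qed.

Lemma lsup_ub A a : A a -> (a <= lsup A)%O.
Proof. by move=> Aa; have [H _] := lsupP A; apply: H. Qed.

Lemma lsup_le A b : (forall a, A a -> (a <= b)%O) -> (lsup A <= b)%O.
Proof. by move=> H; have [_] := lsupP A; apply. Qed.

Lemma linfP A : infimums A (linf A).
Proof.
rewrite /linf /infimum; case: ifPn => [/eqP -> | _].
  by split=> [x []//|y _]; rewrite lex1.
case: xgetP => [y -> //|H]; case: (H (lsup (lbound A))); split.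
  by move=> x Ax; apply: lsup_le => y; apply.
by move=> y; apply: lsup_ub.
Qed.

Lemma linf_lb A a : A a -> (linf A <= a)%O.
Proof. by move=> Aa; have [H _] := linfP A; apply: H. Qed.

Lemma le_linf A b : (forall a, A a -> (b <= a)%O) -> (b <= linf A)%O.
Proof. by move=> H; have [_] := linfP A; apply. Qed.

Lemma rmul_lsup_le a A b :
  (forall c, A c -> (a ** c <= b)%O) -> (a ** lsup A <= b)%O.
Proof.
by move=> H; rewrite rmul_lsupr; apply: lsup_le => _ [c Ac <-]; apply: H.
Qed.

Lemma lsup_top_le A b c : lsup A = \top%O ->
  (forall a, A a -> (a ** b <= c)%O) -> (b <= c)%O.
Proof.
move=> At H; rewrite -(rmul1 b) -At; apply: rmul_lsup_le => a Aa.
by rewrite rmulC; apply: H.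
Qed.

Lemma ler_rmul a b c : (b <= c)%O -> (a ** b <= a ** c)%O.
Proof.
move=> bc; have -> : c = lsup [set b; c].
  apply/le_anti/andP; split; first by apply: lsup_ub; right.
  by apply: lsup_le => x [->|->].
by rewrite rmul_lsupr; apply: lsup_ub; exists b => //; left.
Qed.

Lemma rmul_ler a b : (a ** b <= a)%O.
Proof. by rewrite -[leRHS]rmul1; apply: ler_rmul; rewrite lex1. Qed.

Lemma rmul_le_meet a b : (a ** b <= a `&` b)%O.
Proof. by rewrite lexI rmul_ler rmulC rmul_ler. Qed.

Lemma le_residuum a b c : (c <= residuum a b)%O = (a ** c <= b)%O.
Proof.
apply/idP/idP => [H|H]; last exact: lsup_ub.
by apply: le_trans (ler_rmul a H) _; apply: rmul_lsup_le.
Qed.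

Section Sub.
Variable X : Type.
Implicit Types l m n : X -> L.

Lemma le_subsethood c l m :
  (forall x, (l x ** c <= m x)%O) -> (c <= subsethood l m)%O.
Proof. by move=> H; apply: le_linf => _ [x _ <-]; rewrite le_residuum. Qed.

Lemma subsethoodP l m x : (l x ** subsethood l m <= m x)%O.
Proof. by rewrite -le_residuum; apply: linf_lb; exists x. Qed.

Lemma subsethood_trans l m n :
  (subsethood l m ** subsethood m n <= subsethood l n)%O.
Proof.
apply: le_subsethood => x; rewrite rmulA.
apply: le_trans (subsethoodP m n x).
by rewrite ![_ ** subsethood m n]rmulC; apply/ler_rmul/subsethoodP.
Qed.

Lemma subsethood_top l m :
  (forall x, (l x <= m x)%O) -> subsethood l m = \top%O.
Proof.
by move=> H; apply/eqP; rewrite -le1x; apply: le_subsethood => x; rewrite rmul1.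
Qed.

End Sub.
End Lattice.

Section TopFilters.
Variables (d : Order.disp_t) (L : completeResiduatedLatticeType d).

Record is_topfilter (X : Type) (F : set (X -> L)) : Prop := IsTopFilter {
  topfilter_neq0 : F !=set0;
  topfilter_sup : forall l, F l -> lsup (range l) = \top%O;
  topfilter_meet : forall l m, F l -> F m -> F (lset_meet l m);
  topfilter_sat : forall l,
    lsup [set subsethood m l | m in F] = \top%O -> F l
}.

Record topfilter (X : Type) := TopFilter {
  topfilter_set :> set (X -> L);
  topfilterP : is_topfilter topfilter_set
}.

Record is_topfilter_base (X : Type) (B : set (X -> L)) : Prop :=
  IsTopFilterBase {
  topbase_neq0 : B !=set0;
  topbase_sup : forall l, B l -> lsup (range l) = \top%O;
  topbase_meet : forall l m, B l -> B m ->
    lsup [set subsethood n (lset_meet l m) | n in B] = \top%O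
}.

Definition generated (X : Type) (B : set (X -> L)) : set (X -> L) :=
  [set l | lsup [set subsethood m l | m in B] = \top%O].

Lemma generated_topfilter (X : Type) (B : set (X -> L)) :
  is_topfilter_base B -> is_topfilter (generated B).
Proof.
move=> [[n0 Bn0] Bs Bm].
have sub n l : B n -> (subsethood n l <= lsup [set subsethood m l | m in B])%O.
  by move=> Bn; apply: lsup_ub; exists n.
split.
- exists n0; apply/eqP; rewrite -le1x -(subsethood_top (l := n0) (m := n0)) //.
  exact: sub.
- move=> l gl; apply/eqP; rewrite -le1x; rewrite -gl.
  apply: lsup_le => _ [n Bn <-]; apply: lsup_top_le (Bs _ Bn) _ => _ [x _ <-].
  by apply: le_trans (subsethoodP n l x) _; apply: lsup_ub; exists x.
- move=> l m gl gm; apply/eqP; rewrite -le1x -[leLHS]gl.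
  apply: lsup_le => _ [n1 B1 <-]; apply: lsup_top_le gm _ => _ [n2 B2 <-].
  apply: lsup_top_le (Bm _ _ B1 B2) _ => _ [n Bn <-].
  apply: le_trans (sub _ _ Bn); apply: le_subsethood => x; rewrite lexI.
  set s := subsethood n _.
  have H : (n x ** s <= n1 x `&` n2 x)%O by apply: (subsethoodP n (lset_meet n1 n2)).
  move: H; rewrite lexI => /andP[H1 H2]; rewrite rmulA.
  apply/andP; split.
    rewrite [subsethood n2 m ** _]rmulC rmulA; apply: le_trans (rmul_ler _ _) _.
    apply: le_trans (subsethoodP n1 l x).
    by rewrite ![_ ** subsethood n1 l]rmulC; apply: ler_rmul.
  rewrite rmulA; apply: le_trans (rmul_ler _ _) _.
  apply: le_trans (subsethoodP n2 m x).
  by rewrite ![_ ** subsethood n2 m]rmulC; apply: ler_rmul.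
- move=> l gl; apply/eqP; rewrite -le1x -[leLHS]gl.
  apply: lsup_le => _ [m gm <-]; apply: lsup_top_le gm _ => _ [n Bn <-].
  by apply: le_trans (subsethood_trans n m l) _; apply: sub.
Qed.

Lemma topfilter_up (X : Type) (F : set (X -> L)) l m : is_topfilter F ->
  F l -> (forall x, (l x <= m x)%O) -> F m.
Proof.
move=> FF Fl lm; apply: (topfilter_sat FF); apply/eqP; rewrite -le1x.
by apply: lsup_ub; exists l => //; apply: subsethood_top.
Qed.

Lemma point_is_topfilter (X : Type) (x : X) :
  is_topfilter [set l : X -> L | l x = \top%O].
Proof.
split.
- by exists (fun=> \top%O).
- by move=> l lx; apply/eqP; rewrite -le1x; apply: lsup_ub; exists x.
- by move=> l m /= lx mx; rewrite /lset_meet lx mx meetxx.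
- move=> l /= ltop; apply/eqP; rewrite -le1x -ltop.
  apply: lsup_le => _ [m mx <-].
  by have := subsethoodP m l x; rewrite (mx : m x = \top%O) rmulC rmul1.
Qed.

Definition point_topfilter (X : Type) (x : X) : topfilter X :=
  TopFilter (point_is_topfilter x).

Lemma image_is_topfilter (X Y : Type) (f : X -> Y) (F : topfilter X) :
  is_topfilter [set l : Y -> L | topfilter_set F (l \o f)].
Proof.
have FF := topfilterP F; split.
- have [l Fl] := topfilter_neq0 FF; exists (fun=> \top%O) => /=.
  by apply: topfilter_up FF Fl _ => x; rewrite lex1.
- move=> l /(topfilter_sup FF) H; apply/eqP; rewrite -le1x -H.
  by apply: lsup_le => _ [x _ <-]; apply: lsup_ub; exists (f x).
- by move=> l m; apply: (topfilter_meet FF).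
- move=> l ltop; apply: (topfilter_sat FF); apply/eqP; rewrite -le1x -ltop.
  apply: lsup_le => _ [m Fm <-].
  apply: (@le_trans _ _ (subsethood (m \o f) (l \o f))).
    by apply: le_subsethood => x; apply: (subsethoodP m l (f x)).
  by apply: lsup_ub; exists (m \o f).
Qed.

Definition image_topfilter (X Y : Type) (f : X -> Y) (F : topfilter X) :
  topfilter Y := TopFilter (image_is_topfilter f F).

Record topconv (X : Type) := TopConv {
  tlim :> topfilter X -> set X;
  tlim_point : forall x, tlim (point_topfilter x) x;
  tlim_sub : forall (F G : topfilter X) x,
    F `<=` G -> tlim F x -> tlim G x
}.

Definition tcontinuous (X Y : Type) (CX : topconv X) (CY : topconv Y)
    (f : X -> Y) : Prop :=
  forall (F : topfilter X) (x : X), CX F x -> CY (image_topfilter f F) (f x).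

Definition prod_tlim (X Y : Type) (CX : topconv X) (CY : topconv Y)
    (F : topfilter (X * Y)) : set (X * Y) :=
  [set p | CX (image_topfilter fst F) p.1 /\ CY (image_topfilter snd F) p.2].

Lemma prod_tlim_point (X Y : Type) (CX : topconv X) (CY : topconv Y) p :
  prod_tlim CX CY (point_topfilter p) p.
Proof.
by split; [apply: tlim_sub (tlim_point CX p.1)
          |apply: tlim_sub (tlim_point CY p.2)].
Qed.

Lemma prod_tlim_sub (X Y : Type) (CX : topconv X) (CY : topconv Y)
    (F G : topfilter (X * Y)) p :
  F `<=` G -> prod_tlim CX CY F p -> prod_tlim CX CY G p.
Proof.
move=> FG [H1 H2].
by split; [apply: tlim_sub H1 | apply: tlim_sub H2] => l; apply: FG.
Qed.

Definition prod_topconv (X Y : Type) (CX : topconv X) (CY : topconv Y) :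
    topconv (X * Y) :=
  TopConv (@prod_tlim_point X Y CX CY) (@prod_tlim_sub X Y CX CY).

Section Group.
Variable X : groupType.

Definition is_topconv_group (C : topconv X) : Prop :=
  tcontinuous (prod_topconv C C) C (fun p : X * X => p.1 * p.2) /\
  tcontinuous C C (fun x : X => x^-1).

(* p ranges over the pairs (x, y) with x * y = z. *)
Definition lset_odot (l m : X -> L) : X -> L := fun z =>
  lsup [set (l p.1 `&` m p.2)%O | p in [set p : X * X | p.1 * p.2 = z]].

Definition lset_inv (l : X -> L) : X -> L := fun z => l z^-1.

Definition odot_base (F G : set (X -> L)) : set (X -> L) :=
  [set lset_odot l m | l in F & m in G].

Lemma le_lset_odot (l l' m m' : X -> L) : (forall x, (l x <= l' x)%O) ->
  (forall x, (m x <= m' x)%O) -> forall z, (lset_odot l m z <= lset_odot l' m' z)%O.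
Proof.
move=> ll' mm' z; apply: lsup_le => _ [p pz <-].
by apply: (le_trans (leI2 (ll' _) (mm' _))); apply: lsup_ub; exists p.
Qed.

Lemma odot_is_base (F G : topfilter X) : is_topfilter_base (odot_base F G).
Proof.
have [FF FG] := (topfilterP F, topfilterP G); split.
- have [[l Fl] [m Gm]] := (topfilter_neq0 FF, topfilter_neq0 FG).
  by exists (lset_odot l m); exists l => //; exists m.
- move=> _ [l Fl [m Gm <-]]; apply/eqP; rewrite -le1x.
  rewrite -(topfilter_sup FF Fl); apply: lsup_le => _ [x _ <-].
  apply: lsup_top_le (topfilter_sup FG Gm) _ => _ [y _ <-].
  rewrite rmulC; apply: le_trans (rmul_le_meet _ _) _.
  apply: (@le_trans _ _ (lset_odot l m (x * y))).
    by apply: lsup_ub; exists (x, y).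
  by apply: lsup_ub; exists (x * y).
- move=> _ _ [l Fl [m Gm <-]] [l' Fl' [m' Gm' <-]]; apply/eqP; rewrite -le1x.
  apply: lsup_ub; exists (lset_odot (lset_meet l l') (lset_meet m m')).
    exists (lset_meet l l'); first exact: (topfilter_meet FF).
    by exists (lset_meet m m') => //; apply: (topfilter_meet FG).
  apply: subsethood_top => z; rewrite lexI; apply/andP; split;
    by apply: le_lset_odot => x; rewrite ?leIl ?leIr.
Qed.

Definition odot_topfilter (F G : topfilter X) : topfilter X :=
  TopFilter (generated_topfilter (odot_is_base F G)).

Lemma inv_is_topfilter (F : topfilter X) : is_topfilter (lset_inv @` F).
Proof.
suff -> : lset_inv @` F = image_topfilter (fun x : X => x^-1) F
  by apply: topfilterP.
have lset_invK l : lset_inv (lset_inv l) = l by apply/funext => z; rewrite /lset_inv invgK.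
apply/seteqP; split=> l.
  by case=> m Fm <-; rewrite /= (lset_invK m : lset_inv m \o _ = m).
by move=> Fl; exists (lset_inv l).
Qed.

Definition inv_topfilter (F : topfilter X) : topfilter X :=
  TopFilter (inv_is_topfilter F).

End Group.
End TopFilters.

(* Main.v *)
Require Import Defs.
From mathcomp Require Import all_boot all_order.
From mathcomp Require Import boolp classical_sets.

(** Two $\top$-filters F and G have a product F x G on the Cartesian product,
    generated by the rectangles (x, y) |-> l x /\ m y with l in F and m in G.
    Two facts relate filters on X * X to the group multiplication.

    - The image of F x G under the multiplication is contained in F (.) G
      ([image_mul_prod_topfilter]): l (.) m is the image of the rectangle of l
      and m along the multiplication, and taking images is left adjoint to
      composing with the multiplication ([subsethood_odot]).
    - Every $\top$-filter H on X * X has an image under the multiplication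
      that contains the product p_1(H) (.) p_2(H) of its projections
      ([odot_image_projections]).  Indeed H contains the rectangles with sides
      in its projections, and a rectangle lies below the pullback of its image
      ([rectangle_le_odot], the unit of the same adjunction).

    If the multiplication is continuous and F, G converge to x, y, then F x G
    converges to (x, y), because its projections contain F and G, and a filter
    containing a convergent one converges; hence mul(F x G) converges to x * y,
    and so does the larger F (.) G.  Conversely, let H converge to (x, y).  If
    convergence is compatible with (.), the product of the projections of H
    converges to x * y, and so does the larger mul(H).  For the inverse there
    is nothing to compare: F^-1 is the image of F under inversion
    ([inv_topfilterE]). *)

Set Implicit Arguments.
Unset Strict Implicit.
Unset Printing Implicit Defensive.

Import Order.TTheory.
Local Open Scope classical_set_scope.
Local Open Scope reslat_scope.

Section Generated.
Variables (d : Order.disp_t) (L : completeResiduatedLatticeType d) (X : Type).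
Implicit Types (B F : set (X -> L)) (l m : X -> L).

Lemma generated_base B l : B l -> generated B l.
Proof.
move=> Bl; apply/eqP; rewrite -le1x.
by apply: lsup_ub; exists l => //; apply: subsethood_top.
Qed.

Lemma generated_sub B F : is_topfilter F -> B `<=` F -> generated B `<=` F.
Proof.
move=> FF BF l gl; apply: (topfilter_sat FF); apply/eqP; rewrite -le1x -gl.
by apply: lsup_le => _ [m Bm <-]; apply: lsup_ub; exists m => //; apply: BF.
Qed.

End Generated.

Section Product.
Variables (d : Order.disp_t) (L : completeResiduatedLatticeType d).
Variables X Y : Type.
Implicit Types (F : topfilter L X) (G : topfilter L Y).

Definition rectangle (l : X -> L) (m : Y -> L) : X * Y -> L :=
  lset_meet (l \o fst) (m \o snd).

Definition rectangle_base (F : set (X -> L)) (G : set (Y -> L)) :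
    set (X * Y -> L) :=
  [set rectangle l m | l in F & m in G].

Lemma rectangle_is_base F G : is_topfilter_base (rectangle_base F G).
Proof.
have [FF FG] := (topfilterP F, topfilterP G); split.
- have [[l Fl] [m Gm]] := (topfilter_neq0 FF, topfilter_neq0 FG).
  by exists (rectangle l m); exists l => //; exists m.
- (* Finite meets need not distribute over suprema in L; the residuated
     product does, and lies below the meet. *)
  move=> _ [l Fl [m Gm <-]]; apply/eqP; rewrite -le1x.
  rewrite -(topfilter_sup FF Fl); apply: lsup_le => _ [x _ <-].
  apply: lsup_top_le (topfilter_sup FG Gm) _ => _ [y _ <-].
  rewrite rmulC; apply: le_trans (rmul_le_meet _ _) _.
  by apply: lsup_ub; exists (x, y).
- move=> _ _ [l Fl [m Gm <-]] [l' Fl' [m' Gm' <-]].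
  apply: generated_base; exists (lset_meet l l').
    exact: (topfilter_meet FF).
  exists (lset_meet m m'); first exact: (topfilter_meet FG).
  by apply/funext => p; rewrite /rectangle /lset_meet /= meetACA.
Qed.

Definition prod_topfilter F G : topfilter L (X * Y) :=
  TopFilter (generated_topfilter (rectangle_is_base F G)).

Lemma image_fst_prod_topfilter F G :
  F `<=` image_topfilter fst (prod_topfilter F G).
Proof.
move=> l Fl; have [m Gm] := topfilter_neq0 (topfilterP G).
have base : topfilter_set (prod_topfilter F G) (rectangle l m).
  by apply: generated_base; exists l => //; exists m.
by apply: topfilter_up (topfilterP _) base _ => p; apply: leIl.
Qed.

Lemma image_snd_prod_topfilter F G :
  G `<=` image_topfilter snd (prod_topfilter F G).
Proof.
move=> m Gm; have [l Fl] := topfilter_neq0 (topfilterP F).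
have base : topfilter_set (prod_topfilter F G) (rectangle l m).
  by apply: generated_base; exists l => //; exists m.
by apply: topfilter_up (topfilterP _) base _ => p; apply: leIr.
Qed.

Lemma prod_topfilter_lim (CX : topconv L X) (CY : topconv L Y) F G x y :
  CX F x -> CY G y -> prod_topconv CX CY (prod_topfilter F G) (x, y).
Proof.
move=> Fx Gy; split.
- exact: tlim_sub (@image_fst_prod_topfilter F G) Fx.
- exact: tlim_sub (@image_snd_prod_topfilter F G) Gy.
Qed.

End Product.

Section Group.
Variables (d : Order.disp_t) (L : completeResiduatedLatticeType d).
Variable X : groupType.
Implicit Types (F G : topfilter L X) (l m n : X -> L).

Let mul (p : X * X) : X := (p.1 * p.2)%g.

(** One half of the adjunction between images and composition along the
    multiplication, in its graded form: any degree c with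
    (l x /\ m y) ** c <= n (x * y) for all x, y still works after taking the
    supremum over each fibre of the multiplication, because ** preserves
    suprema. *)
Lemma subsethood_odot l m n :
  (subsethood (rectangle l m) (n \o mul) <= subsethood (lset_odot l m) n)%O.
Proof.
apply: le_subsethood => z; rewrite rmulC.
apply: rmul_lsup_le => _ [p <- <-]; rewrite rmulC.
exact: (subsethoodP (rectangle l m) (n \o mul) p).
Qed.

Lemma rectangle_le_odot l m p : (rectangle l m p <= lset_odot l m (mul p))%O.
Proof. by apply: lsup_ub; exists p. Qed.

Lemma image_mul_prod_topfilter F G :
  image_topfilter mul (prod_topfilter F G) `<=` odot_topfilter F G.
Proof.
move=> n Hn; apply/eqP; rewrite -le1x -[leLHS]Hn.
apply: lsup_le => _ [_ [l Fl [m Gm <-]] <-].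
apply: le_trans (subsethood_odot l m n) _.
by apply: lsup_ub; exists (lset_odot l m) => //; exists l => //; exists m.
Qed.

Lemma odot_image_projections (H : topfilter L (X * X)) :
  odot_topfilter (image_topfilter fst H) (image_topfilter snd H)
    `<=` image_topfilter mul H.
Proof.
apply: generated_sub; first exact: topfilterP.
move=> _ [l Hl [m Hm <-]].
have Hlm : topfilter_set H (rectangle l m) :=
  topfilter_meet (topfilterP H) Hl Hm.
exact: topfilter_up (topfilterP H) Hlm (@rectangle_le_odot l m).
Qed.

Lemma inv_topfilterE F :
  inv_topfilter F = image_topfilter (fun x : X => x^-1%g) F :> set (X -> L).
Proof.
have invK l : lset_inv (lset_inv l) = l.
  by apply/funext => z; rewrite /lset_inv invgK.
apply/seteqP; split=> [_ [l Fl <-] | l Fl].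
- by rewrite -(invK l) in Fl.
- by exists (lset_inv l).
Qed.

End Group.

Theorem theorem3p4 (d : Order.disp_t) (L : completeResiduatedLatticeType d)
    (X : groupType) (C : topconv L X) :
  is_topconv_group C <->
  (forall (F G : topfilter L X) (x y : X),
     C F x -> C G y -> C (odot_topfilter F G) (x * y)%g) /\
  (forall (F : topfilter L X) (x : X),
     C F x -> C (inv_topfilter F) (x^-1)%g).
Proof.
split=> [[mul_cont inv_cont] | [odot_lim inv_lim]]; split.
- move=> F G x y Fx Gy; apply: tlim_sub (@image_mul_prod_topfilter _ _ _ F G) _.
  exact: mul_cont (prod_topfilter_lim Fx Gy).
- move=> F x /inv_cont; apply: tlim_sub.
  by rewrite inv_topfilterE.
- move=> H [x y] [Hx Hy].
  exact: tlim_sub (@odot_image_projections _ _ _ H) (odot_lim _ _ _ _ Hx Hy).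
- move=> F x /inv_lim; apply: tlim_sub.
  by rewrite inv_topfilterE.
Qed.
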